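(* Let $m$ and $n$ be arbitrary integers, and for $i\in\mathbb{N}_0$ let $e_i=(n+i,m+i)\in E(\mathscr{C}_{\mathbb{Z}}^{m,n})$. Then for all $i,j\in\mathbb{N}_0$, $e_i\preccurlyeq e_j$ in $E(\mathscr{C}_{\mathbb{Z}}^{m,n})$ if and only if $j\leqslant i$; hence $E(\mathscr{C}_{\mathbb{Z}}^{m,n})$ is an $\omega$-chain.
   Context: $\mathbb{N}_0$ is the set of non-negative integers. The extended bicyclic semigroup $\mathscr{C}_{\mathbb{Z}}$ is the set $\mathbb{Z}\times\mathbb{Z}$ with the associative operation $(a,b)\cdot(c,d)=(a-b+c,d)$ if $b<c$; $(a,d)$ if $b=c$; $(a,d+b-c)$ if $b>c$. For integers $m,n$, the variant $\mathscr{C}_{\mathbb{Z}}^{m,n}$ is the set $\mathbb{Z}\times\mathbb{Z}$ with the semigroup operation $(a,b)\ast_{m,n}(c,d)=(a,b)\cdot(m,n)\cdot(c,d)$. $E(\mathscr{C}_{\mathbb{Z}}^{m,n})$ denotes the set of idempotents of $\mathscr{C}_{\mathbb{Z}}^{m,n}$; it is equal to $\{(n+i,m+i)\colon i\in\mathbb{N}_0\}$. The natural partial order on idempotents is: $e\preccurlyeq f$ if and only if $e\ast_{m,n}f=f\ast_{m,n}e=e$. A semilattice (commutative semigroup of idempotents) is a chain if its natural partial order is linear, and an $\omega$-chain is a chain isomorphic to $\{0,-1,-2,-3,\ldots\}$ with the usual order $\leqslant$, equivalently a semilattice isomorphic to $(\mathbb{N}_0,\max)$. *)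

(* Defs.v *)
From mathcomp Require Import all_boot all_order all_algebra.
Set Implicit Arguments.
Unset Strict Implicit.
Unset Printing Implicit Defensive.
Import Order.TTheory GRing.Theory Num.Theory.
Local Open Scope ring_scope.

Section SemilatticeNotions.
Variables (T : eqType) (op : T -> T -> T).

Definition idempotents : {pred T} := [pred e | op e e == e].

Definition natural_le : rel T := fun e f => (op e f == e) && (op f e == e).

Definition semilattice (A : {pred T}) : Prop :=
  [/\ {in A &, forall e f, op e f \in A},
      {in A & &, associative op},
      {in A &, commutative op}
    & {in A, forall e, op e e = e}].

(* On a semilattice natural_le is always a partial order, so linearity amounts
   to totality. *)
Definition chain (A : {pred T}) : Prop :=
  semilattice A /\ {in A &, total natural_le}.

(* {k : int | k <= 0} is {0, -1, -2, ...} with its usual order. *)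
Definition omega_chain (A : {pred T}) : Prop :=
  chain A /\
  exists phi : {x : T | x \in A} -> {k : int | k <= 0},
    bijective phi /\
    forall x y, natural_le (val x) (val y) <-> val (phi x) <= val (phi y).

End SemilatticeNotions.

Definition ext_bicyclic_mul (x y : int * int) : int * int :=
  let: (a, b) := x in
  let: (c, d) := y in
  if b < c then (a - b + c, d)
  else if b == c then (a, d)
  else (a, d + b - c).

Definition variant_mul (m n : int) (x y : int * int) : int * int :=
  ext_bicyclic_mul (ext_bicyclic_mul x (m, n)) y.

(* Main.v *)
Require Import Defs.
From mathcomp Require Import all_boot all_order all_algebra.
From mathcomp Require Import zify.
Import Order.TTheory GRing.Theory Num.Theory.
Local Open Scope ring_scope.

(* The idempotent e_i e_j is e_{max(i,j)}, so sending e_i to -i identifies the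
   idempotents with the non-positive integers, and e_i <= e_j iff max(i,j) = i. *)

(** Computing with the factor [(m, n)] in the middle shows that every idempotent is some e_i
    ([variant_idempotentP]) and that indices multiply by max ([variant_mul_idem]). Since i is
    determined by e_i, the semilattice laws and the order reduce to facts about max on the
    naturals. *)

Definition variant_idem (m n : int) (i : nat) : int * int :=
  (n + i%:Z, m + i%:Z).

Lemma variant_idem_inj m n : injective (variant_idem m n).
Proof. by move=> i j [/addrI []]. Qed.

(** As [m + i] is at least [m], e_i times [(m, n)] is [(n + i, n + i)]. The second product compares
    [n + i] with [n + j], and the larger index survives. *)
Lemma variant_mul_idem m n i j :
  variant_mul m n (variant_idem m n i) (variant_idem m n j) =
  variant_idem m n (maxn i j).
Proof.
rewrite /variant_mul /variant_idem /ext_bicyclic_mul.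
by do 2![case: ltgtP => ?]; congr pair; lia.
Qed.

(** Let [x = (a, b)] be idempotent. The case [b < m] is contradictory; otherwise the first product
    is [(a, n + b - m)], and idempotency forces [a - n = b - m], which is nonnegative and serves as
    the index. *)
Lemma variant_idempotentP m n x :
  reflect (exists i, x = variant_idem m n i)
          (x \in idempotents (variant_mul m n)).
Proof.
apply: (iffP eqP) => [|[i ->]]; last by rewrite variant_mul_idem maxnn.
case: x => a b; rewrite /variant_mul /variant_idem /ext_bicyclic_mul => xx.
exists `|a - n|%N; move/eqP: xx.
by do 2![case: ltgtP => ?]; rewrite xpair_eqE => /andP[/eqP ? /eqP ?];
  congr pair; lia.
Qed.

(** By symmetry of max, both equations of the order say that e_max(i,j) is e_i; injectivity turns
    this into max(i,j) = i. *)
Lemma variant_idem_le m n i j :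
  natural_le (variant_mul m n) (variant_idem m n i) (variant_idem m n j) =
  (j <= i)%N.
Proof.
rewrite /natural_le !variant_mul_idem !(inj_eq (@variant_idem_inj m n)).
by rewrite (maxnC j) andbb; apply/eqP/idP => /maxn_idPl.
Qed.

Lemma variant_idem_chain m n :
  chain (variant_mul m n) (idempotents (variant_mul m n)).
Proof.
split; first split.
- move=> _ _ /variant_idempotentP[i ->] /variant_idempotentP[j ->].
  by apply/variant_idempotentP; exists (maxn i j); rewrite variant_mul_idem.
- move=> _ _ _ /variant_idempotentP[i ->] /variant_idempotentP[j ->]
    /variant_idempotentP[k ->].
  by rewrite !variant_mul_idem maxnA.
- move=> _ _ /variant_idempotentP[i ->] /variant_idempotentP[j ->].
  by rewrite !variant_mul_idem maxnC.
- by move=> x /eqP.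
- move=> _ _ /variant_idempotentP[i ->] /variant_idempotentP[j ->].
  by rewrite !variant_idem_le leq_total.
Qed.

Lemma variant_idem_omega_chain m n :
  omega_chain (variant_mul m n) (idempotents (variant_mul m n)).
Proof.
split; first exact: variant_idem_chain.
have phiP (x : int * int) : - `|x.1 - n| <= 0 by rewrite oppr_le0.
have psiP i : variant_idem m n i \in idempotents (variant_mul m n).
  by apply/variant_idempotentP; exists i.
(* On idempotents [x.1 - n] is the index, so e_i goes to -i; the absolute value secures the bound
   [<= 0] for every pair. The inverse sends k to e_i with i = -k. *)
exists (fun x => exist _ (- `|(val x).1 - n|) (phiP (val x))); split.
  exists (fun k => exist _ (variant_idem m n `|val k|%N) (psiP _)).
    move=> [x Ex]; apply: val_inj => /=.
    have /variant_idempotentP[i ->] := Ex.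
    by congr variant_idem => /=; lia.
  by move=> [k k_le0]; apply: val_inj => /=; lia.
move=> [x Ex] [y Ey] /=.
have /variant_idempotentP[i ->] := Ex; have /variant_idempotentP[j ->] := Ey.
by rewrite variant_idem_le /=; lia.
Qed.

Theorem lemma2p3 (m n : int) :
  let op := variant_mul m n in
  let E := idempotents op in
  let e (i : nat) : int * int := (n + i%:Z, m + i%:Z) in
  [/\ forall i : nat, e i \in E,
      forall i j : nat, natural_le op (e i) (e j) <-> (j <= i)%N
    & omega_chain op E].
Proof.
split=> [i | i j |]; last exact: variant_idem_omega_chain.
  by apply/variant_idempotentP; exists i.
by rewrite variant_idem_le.
Qed.
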